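(* Let $\mathbf X$ be a CAT(0) cube complex and let $\gamma:[0,\infty)\to\mathbf X$ be a combinatorial geodesic ray. For $i\ge 0$ let $H_i$ be the hyperplane dual to the 1-cube $\gamma([i,i+1])$. Let $\Gamma(\gamma)$ be the path in the contact graph $\Gamma\mathbf X$ whose consecutive vertices are $H_0,H_1,H_2,\dots$ (the projection of $\gamma$ to $\Gamma\mathbf X$), and let $\Lambda(\gamma)$ be the full subgraph of $\Gamma\mathbf X$ induced by the set $\mathcal W(\gamma)$ of hyperplanes crossing $\gamma$. Then one of the following holds: (1) the inclusions $\Gamma(\gamma)\hookrightarrow\Gamma\mathbf X$ and $\Lambda(\gamma)\hookrightarrow\Gamma\mathbf X$ are quasi-isometric embeddings (with respect to the path metrics on $\Gamma(\gamma)$, $\Lambda(\gamma)$ and $\Gamma\mathbf X$); (2) for every $p\ge 0$, the complete bipartite graph $K_{p,p}$ is a subgraph of $\Lambda(\gamma)$; (3) there exists $R\ge 0$ such that for every $t\ge 0$ there is a hyperplane $H$ such that $\gamma\cap N_R(H)$ contains a connected subpath of $\gamma$ of length at least $t$.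
   Context: A CAT(0) cube complex $\mathbf X$ is a simply connected cell complex built from Euclidean cubes $[-\frac12,\frac12]^d$ ($d$ finite), any two of which meet in a common face or not at all, such that the link of every 0-cube is a flag complex. A midcube of a cube is obtained by setting one coordinate equal to $0$; a hyperplane is a connected subspace meeting each cube either in a midcube or not at all. Each hyperplane $H$ separates $\mathbf X$ into exactly two components (halfspaces). The carrier $N(H)$ is the union of all closed cubes meeting $H$. A 1-cube is dual to $H$ if $H$ meets it. Two hyperplanes contact if their carriers intersect. The combinatorial metric is the path metric on the 1-skeleton with unit-length edges; a combinatorial geodesic ray is a geodesic ray $\gamma:[0,\infty)\to\mathbf X^1$ in this metric sending integers to 0-cubes (equivalently a combinatorial path with at most one 1-cube dual to each hyperplane). A hyperplane crosses $\gamma$ if it is dual to a 1-cube of $\gamma$. The contact graph $\Gamma\mathbf X$ has the hyperplanes as vertices, with distinct hyperplanes adjacent iff they contact. For a hyperplane $H$ and $R\ge 0$, $N_R(H)$ denotes the $R$-neighbourhood of $H$, i.e. the smallest subcomplex containing all 0-cubes at combinatorial distance at most $R$ from the carrier $N(H)$. *)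

(* Defs.v *)
From Stdlib Require Import Relations.Relation_Operators.
From mathcomp Require Import all_boot.

Set Implicit Arguments.
Unset Strict Implicit.
Unset Printing Implicit Defensive.

(* A d-cube is given by its (injective) vertex map from {0,1}^d into the set *)
(* of 0-cubes V.  The complex is the union of its closed cubes, glued along  *)
(* common faces (see the axioms in [cube_complex]).                          *)
Record CubeData := {
  cV :> Type;
  cube : forall d : nat, ({ffun 'I_d -> bool} -> cV) -> Prop
}.

Inductive chain {T : Type} (r : T -> T -> Prop) : nat -> T -> T -> Prop :=
| chain0 n x : chain r n x x
| chainS n x y z : r x y -> chain r n y z -> chain r n.+1 x z.

Section CubeComplex.
Variable X : CubeData.

Definition img d (c : {ffun 'I_d -> bool} -> X) (v : X) : Prop :=
  exists x, c x = v.

Definition faceset d (c : {ffun 'I_d -> bool} -> X)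
    (A : {ffun 'I_d -> option bool}) (v : X) : Prop :=
  exists x : {ffun 'I_d -> bool}, (forall j b, A j = Some b -> x j = b) /\ c x = v.

Definition ins d (i : 'I_d.+1) (b : bool) (x : {ffun 'I_d -> bool})
  : {ffun 'I_d.+1 -> bool} :=
  [ffun j => if unlift i j is Some k then x k else b].

Definition csym d (s : 'I_d -> 'I_d) (f : {ffun 'I_d -> bool})
    (x : {ffun 'I_d -> bool}) : {ffun 'I_d -> bool} :=
  [ffun j => x (s j) (+) f j].

Definition e0 : {ffun 'I_1 -> bool} := [ffun _ => false].
Definition e1 : {ffun 'I_1 -> bool} := [ffun _ => true].
Definition pt2 (a b : bool) : {ffun 'I_2 -> bool} :=
  [ffun j : 'I_2 => if val j == 0%N then a else b].
Definition origin d : {ffun 'I_d -> bool} := [ffun _ => false].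
Definition unitv d (i : 'I_d) : {ffun 'I_d -> bool} := [ffun j => j == i].

Definition adj (u v : X) : Prop :=
  exists c, @cube X 1 c /\ c e0 = u /\ c e1 = v.

Inductive walk : seq X -> Prop :=
| walk1 x : walk [:: x]
| walkS x y p : adj x y -> walk (y :: p) -> walk (x :: y :: p).

Definition hstep (p q : seq X) : Prop :=
  (exists a b x y, adj x y /\ p = a ++ [:: x; y; x] ++ b /\ q = a ++ x :: b)
  \/ (exists a b c, @cube X 2 c /\
        p = a ++ [:: c (pt2 false false); c (pt2 true false); c (pt2 true true)] ++ b /\
        q = a ++ [:: c (pt2 false false); c (pt2 false true); c (pt2 true true)] ++ b).

Definition homotopic := clos_refl_sym_trans (seq X) hstep.

Definition cube_complex : Prop :=
  [/\ (forall d c, @cube X d c -> injective c),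
      (forall v : X, @cube X 0 (fun _ => v)),
      (forall d c (s : 'I_d -> 'I_d) f, injective s -> @cube X d c ->
          @cube X d (fun x => c (csym s f x))),
      (forall d c (i : 'I_d.+1) b, @cube X d.+1 c -> @cube X d (fun x => c (ins i b x)))
    & (forall d1 d2 c1 c2, @cube X d1 c1 -> @cube X d2 c2 ->
          (exists v, img c1 v /\ img c2 v) ->
          exists A1 A2, forall v,
            ((img c1 v /\ img c2 v) <-> faceset c1 A1 v) /\
            ((img c1 v /\ img c2 v) <-> faceset c2 A2 v))].

Definition flag_links : Prop :=
  forall (v : X) n (w : 'I_n -> X), injective w ->
    (forall i, adj v (w i)) ->
    (forall i j, i <> j -> exists c, @cube X 2 c /\ c (pt2 false false) = v /\
        c (pt2 true false) = w i /\ c (pt2 false true) = w j) ->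
    exists c, @cube X n c /\ c (origin n) = v /\ forall i, c (unitv i) = w i.

(* simple connectivity (via the edge-path group of the 2-skeleton) *)
Definition simply_connected : Prop :=
  [/\ inhabited X,
      (forall u v : X, exists n, chain adj n u v)
    & (forall x p, walk (x :: p) -> last x p = x -> homotopic (x :: p) [:: x])].

Definition CAT0 : Prop := [/\ cube_complex, flag_links & simply_connected].

Definition is_edge (e : X * X) : Prop := adj e.1 e.2.

Definition sqopp (e f : X * X) : Prop :=
  exists c, @cube X 2 c /\ e = (c (pt2 false false), c (pt2 true false)) /\
                          f = (c (pt2 false true), c (pt2 true true)).

(* [theta e f]: the (oriented) 1-cubes e and f are dual to the same hyperplane.
   A hyperplane is identified with the class of 1-cubes dual to it. *)
Definition theta : X * X -> X * X -> Prop :=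
  clos_refl_sym_trans (X * X) (fun e f => sqopp e f \/ f = (e.2, e.1)).

Definition in_carrier (h : X * X) (v : X) : Prop :=
  exists e, theta h e /\ (e.1 = v \/ e.2 = v).

(* 0-cubes of N_R(H) (a cube lies in N_R(H) iff all its 0-cubes do) *)
Definition in_NR (R : nat) (h : X * X) (v : X) : Prop :=
  exists w, in_carrier h w /\ chain adj R v w.

(* contact (or equality) of the hyperplanes dual to e and f *)
Definition contact (e f : X * X) : Prop :=
  is_edge e /\ is_edge f /\
  exists e' f', theta e e' /\ theta f f' /\
     (e'.1 = f'.1 \/ e'.1 = f'.2 \/ e'.2 = f'.1 \/ e'.2 = f'.2).

Definition geodesic_ray (g : nat -> X) : Prop :=
  (forall i, adj (g i) (g i.+1)) /\
  (forall i j n, chain adj n (g i) (g (i + j)) -> j <= n).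

Definition Hy (g : nat -> X) (i : nat) : X * X := (g i, g i.+1).

(* adjacency (or equality) in Lambda(gamma), indexed by the H_i *)
Definition lam_rel (g : nat -> X) (i j : nat) : Prop := contact (Hy g i) (Hy g j).

Definition qi_alternative (g : nat -> X) : Prop :=
  (exists L C : nat,
     (forall i j n, chain contact n (Hy g i) (Hy g (i + j)) -> j <= L * n + C) /\
     (forall i j, chain contact (L * j + C) (Hy g i) (Hy g (i + j)))) /\
  (exists L C : nat,
     (forall i j n, chain contact n (Hy g i) (Hy g j) -> chain (lam_rel g) (L * n + C) i j) /\
     (forall i j n, chain (lam_rel g) n i j -> chain contact (L * n + C) (Hy g i) (Hy g j))).

Definition Kpp_in_Lambda (g : nat -> X) (p : nat) : Prop :=
  exists a b : 'I_p -> nat,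
    [/\ (forall x y, x <> y -> ~ theta (Hy g (a x)) (Hy g (a y))),
        (forall x y, x <> y -> ~ theta (Hy g (b x)) (Hy g (b y))),
        (forall x y, ~ theta (Hy g (a x)) (Hy g (b y)))
      & (forall x y, contact (Hy g (a x)) (Hy g (b y)))].

Definition fellow_alternative (g : nat -> X) : Prop :=
  exists R : nat, forall t : nat, exists h : X * X, is_edge h /\
    exists a, forall k, a <= k <= a + t -> in_NR R h (g k).

End CubeComplex.

(* Main.v *)
From Stdlib Require Import Relations.Relation_Operators.
Require Import Defs.
From mathcomp Require Import all_boot.
From mathcomp Require Import zify boolp.

Set Implicit Arguments.
Unset Strict Implicit.
Unset Printing Implicit Defensive.

(** The 1-skeleton is shown to be a median graph by letting vertices act on reduced walks from a
    base point, modulo square swaps: the 3-cube condition makes this action well defined and invariant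
    under elementary homotopies, so by simple connectivity geodesics with common endpoints differ by
    swaps.  This gives the quadrangle condition, hence halfspaces [d(x,a) < d(x,b)] that depend only
    on the hyperplane of [ab], convexity of halfspaces and carriers, and gates.

    Suppose [K_{p,p}] is not in [Lambda(gamma)] and [gamma] does not follow any hyperplane at
    distance [2p] for length [t].  Then the carrier of a hyperplane [U] meets both sides of at most
    [2p + t] of the [H_m].  Indeed, replace [U] by the hyperplane closest to [gamma 0] with this
    property for the given [H_m]; then every hyperplane separating a point [gamma k] from the carrier
    of [U] is some [H_r].  If more [H_m] were allowed, some [gamma k], with [p] of the [m] before [k]
    and [p] after, would be more than [2p] away from [U]; among [2p] hyperplanes [H_r] separating it
    from [U], [p] have [r < k] and cross all [H_m] with [m >= k], or [p] have [r >= k] and cross all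
    [H_m] with [m < k].  A contact chain [U_0, ..., U_n] from [H_i] to [H_(i+j)] has, for each of the [j]
    intermediate [H_m], a member whose carrier meets both sides of [H_m], so [j <= (n+1)(2p+t)]. *)

(** * Squares and 3-cubes *)

Section Squares.
Variable X : CubeData.
Hypothesis HX : CAT0 X.

Definition sq (x y z w : X) : Prop := exists c, @cube X 2 c /\
  [/\ c (pt2 false false) = x, c (pt2 true false) = y,
      c (pt2 false true) = z & c (pt2 true true) = w].

Lemma cube_inj d c : @cube X d c -> injective c.
Proof. by case: HX => -[H _ _ _ _] _ _; exact: H. Qed.

Lemma cube_csym d c (s : 'I_d -> 'I_d) f :
  injective s -> @cube X d c -> @cube X d (fun x => c (csym s f x)).
Proof. by case: HX => -[_ _ H _ _] _ _; exact: H. Qed.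

Lemma cube_ins d c (i : 'I_d.+1) b :
  @cube X d.+1 c -> @cube X d (fun x => c (ins i b x)).
Proof. by case: HX => -[_ _ _ H _] _ _; exact: H. Qed.

Lemma pt2_eta (x : {ffun 'I_2 -> bool}) : x = pt2 (x ord0) (x ord_max).
Proof.
apply/ffunP => j; rewrite ffunE.
by case: j => -[|[|//]] H /=; congr (x _); apply: val_inj.
Qed.

Lemma csym_id2 f a b :
  csym id f (pt2 a b) = pt2 (a (+) f ord0) (b (+) f ord_max).
Proof. by rewrite [LHS]pt2_eta !ffunE. Qed.

Lemma csym_rev2 f a b :
  csym (@rev_ord 2) f (pt2 a b) = pt2 (b (+) f ord0) (a (+) f ord_max).
Proof. by rewrite [LHS]pt2_eta !ffunE. Qed.

(** Together with [sq_turn] this generates all eight symmetries of a square. *)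
Lemma sq_swap x y z w : sq x y z w -> sq x z y w.
Proof.
move=> [c [Hc [H1 H2 H3 H4]]].
exists (fun t => c (csym (@rev_ord 2) (origin 2) t)); split.
  by apply: cube_csym Hc; exact: rev_ord_inj.
by rewrite !csym_rev2 !ffunE /= H1 H2 H3 H4.
Qed.

Lemma sq_turn x y z w : sq x y z w -> sq y x w z.
Proof.
move=> [c [Hc [H1 H2 H3 H4]]].
exists (fun t => c (csym id (pt2 true false) t)); split.
  exact: cube_csym Hc.
by rewrite !csym_id2 !ffunE /= H1 H2 H3 H4.
Qed.

Lemma adjC (x y : X) : adj x y -> adj y x.
Proof.
move=> [c [Hc [H1 H2]]].
exists (fun t => c (csym id e1 t)); split; first exact: cube_csym Hc.
by split; rewrite -?H1 -?H2; congr c; apply/ffunP => j; rewrite !ffunE.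
Qed.

Lemma sq_adj x y z w : sq x y z w -> adj x y.
Proof.
move=> [c [Hc [H1 H2 H3 H4]]].
exists (fun t => c (ins ord_max false t)); split; first exact: cube_ins.
have E t : ins ord_max false t = pt2 (t ord0) false.
  rewrite [LHS]pt2_eta !ffunE unlift_none.
  have -> : ord0 = lift ord_max ord0 :> 'I_2 by apply: val_inj.
  by rewrite liftK.
by rewrite !E !ffunE.
Qed.

Lemma sq_neq x y z w : sq x y z w -> y <> z.
Proof.
move=> [c [Hc [H1 H2 H3 H4]]] E; move: H2; rewrite E -H3 => /(cube_inj Hc)/ffunP.
by move=> /(_ ord0); rewrite !ffunE.
Qed.

(** The common face contains three corners of the first square, so no coordinate is fixed and it is
    the whole square; by injectivity [w] can only be the remaining corner of the second square. *)
Lemma sq_uniq x y z w w' : sq x y z w -> sq x y z w' -> w = w'.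
Proof.
move=> [c [Hc [H1 H2 H3 H4]]] [c' [Hc' [H1' H2' H3' H4']]].
case: HX => -[_ _ _ _ /(_ _ _ _ _ Hc Hc')] H _ _.
have {}H : exists A1 A2, forall v,
   (img c v /\ img c' v <-> faceset c A1 v) /\ (img c v /\ img c' v <-> faceset c' A2 v).
  by apply: H; exists x; split; [exists (pt2 false false)|exists (pt2 false false)].
move: H => [A1 [A2 H]].
have F v a b a' b' : c (pt2 a b) = v -> c' (pt2 a' b') = v ->
    forall j b0, A1 j = Some b0 -> pt2 a b j = b0.
  move=> E1 E2; have [[/(_ _)]] := H v; case.
    by split; [exists (pt2 a b)|exists (pt2 a' b')].
  by move=> t [Ht E3] _ _; rewrite -E1 in E3; rewrite -(cube_inj Hc E3).
have N j : A1 j = None.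
  case E : (A1 j) => [b0|//].
  have := F _ _ _ _ _ H1 H1' _ _ E; have := F _ _ _ _ _ H2 H2' _ _ E.
  have := F _ _ _ _ _ H3 H3' _ _ E; rewrite !ffunE.
  by case: (val j == 0) => <-.
have [[_ /(_ _)]] := H w; case.
  by exists (pt2 true true); split=> // j b; rewrite N.
move=> _ [t Et] _; move: Et H1' H2' H3' H4'; rewrite (pt2_eta t).
have D a b : c (pt2 a b) = w -> a && b.
  rewrite -H4 => /(cube_inj Hc)/ffunP P.
  by have := P ord0; have := P ord_max; rewrite !ffunE /= => -> ->.
case: (t ord0) (t ord_max) => -[] -> //; rewrite -?H1 -?H2 -?H3.
- by move=> _ E; have := D _ _ (esym E).
- by move=> _ _ E; have := D _ _ (esym E).
- by move=> E; have := D _ _ (esym E).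
Qed.

Definition pt3 (a b c : bool) : {ffun 'I_3 -> bool} :=
  [ffun j : 'I_3 => if val j == 0 then a else if val j == 1 then b else c].

Lemma ins3 (i : 'I_3) b a c : ins i b (pt2 a c) =
  if val i == 0 then pt3 b a c else if val i == 1 then pt3 a b c else pt3 a c b.
Proof.
apply/ffunP => j; rewrite /ins !ffunE.
case: unliftP => [k|] ->; last first.
  by case: i => -[|[|[|//]]] H; rewrite /= !ffunE.
by case: i => -[|[|[|//]]] H; case: k => -[|[|//]] H'; rewrite /= !ffunE.
Qed.

Lemma sq_of_cube3 c (i : 'I_3) b : @cube X 3 c ->
  sq (c (ins i b (pt2 false false))) (c (ins i b (pt2 true false)))
     (c (ins i b (pt2 false true))) (c (ins i b (pt2 true true))).
Proof. by move=> Hc; exists (fun t => c (ins i b t)); split; first exact: cube_ins. Qed.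

(** The three squares form a triangle in the link of [v], which the flag condition fills by a
    3-cube; [u] is its corner opposite to [v]. *)
Lemma cube_condition v a b c ab ac bc :
  sq v a b ab -> sq v a c ac -> sq v b c bc ->
  exists u, [/\ sq a ab ac u, sq b ab bc u & sq c ac bc u].
Proof.
move=> Hab Hac Hbc.
pose w (i : 'I_3) := if val i == 0 then a else if val i == 1 then b else c.
have [k [Hk [Ho Hu]]] : exists k, @cube X 3 k /\ k (origin 3) = v /\
    forall i, k (unitv i) = w i.
  case: HX => _ F _; apply: F.
  + move=> i j; rewrite /w; have := sq_neq Hab; have := sq_neq Hac; have := sq_neq Hbc.
    by case: i => -[|[|[|//]]] H; case: j => -[|[|[|//]]] H' //= N1 N2 N3 E;
      apply: val_inj => //=; congruence.
  + move=> i; rewrite /w; case: ifP => _; first exact: sq_adj Hab.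
    by case: ifP => _; [exact: sq_adj Hbc|exact: sq_adj (sq_swap Hbc)].
  + have S x y z t : sq x y z t -> exists c0, cube c0 /\
      c0 (pt2 false false) = x /\ c0 (pt2 true false) = y /\ c0 (pt2 false true) = z.
      by move=> [c0 [? [? ? ? _]]]; exists c0.
    move=> i j N; rewrite /w.
    by case: i N => -[|[|[|//]]] H; case: j => -[|[|[|//]]] H' //= N;
      try (by case: N; apply: val_inj); apply: S; (eassumption || apply: sq_swap; eassumption).
have Ev : k (pt3 false false false) = v.
  by rewrite -Ho; congr k; apply/ffunP => j; rewrite !ffunE !if_same.
have E i a' b' c' : (forall j, pt3 a' b' c' j = (j == i)) -> k (pt3 a' b' c') = w i.
  by move=> P; rewrite -Hu; congr k; apply/ffunP => j; rewrite P ffunE.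
have Ea : k (pt3 true false false) = a.
  by rewrite (E (@Ordinal 3 0 isT)) // => -[[|[|[|//]]] H]; rewrite ffunE.
have Eb : k (pt3 false true false) = b.
  by rewrite (E (@Ordinal 3 1 isT)) // => -[[|[|[|//]]] H]; rewrite ffunE.
have Ec : k (pt3 false false true) = c.
  by rewrite (E (@Ordinal 3 2 isT)) // => -[[|[|[|//]]] H]; rewrite ffunE.
have S := sq_of_cube3 _ _ Hk.
have S0 := S (@Ordinal 3 0 isT) false; rewrite !ins3 /= Ev Eb Ec in S0.
have S1 := S (@Ordinal 3 1 isT) false; rewrite !ins3 /= Ev Ea Ec in S1.
have S2 := S (@Ordinal 3 2 isT) false; rewrite !ins3 /= Ev Ea Eb in S2.
have T0 := S (@Ordinal 3 0 isT) true; rewrite !ins3 /= Ea in T0.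
have T1 := S (@Ordinal 3 1 isT) true; rewrite !ins3 /= Eb in T1.
have T2 := S (@Ordinal 3 2 isT) true; rewrite !ins3 /= Ec in T2.
(* By uniqueness of the fourth corner, the faces of the 3-cube at [v] are the three given
   squares. *)
rewrite -(sq_uniq Hab S2) in T0 T1; rewrite -(sq_uniq Hac S1) in T0 T2.
rewrite -(sq_uniq Hbc S0) in T1 T2.
by exists (k (pt3 true true true)).
Qed.

End Squares.

(** * Walks modulo square swaps *)

Section Walks.
Variable X : CubeData.
Hypothesis HX : CAT0 X.
Implicit Types (x y z w : X) (l m p q r : seq X).

Inductive eqv : seq X -> seq X -> Prop :=
| eqv_refl l : eqv l l
| eqv_trans m l r : eqv l m -> eqv m r -> eqv l r
| eqv_sq x y z w l : sq x y z w -> eqv (x :: y :: w :: l) (x :: z :: w :: l)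
| eqv_cons x l m : eqv l m -> eqv (x :: l) (x :: m).

Lemma eqv_sym l m : eqv l m -> eqv m l.
Proof.
elim=> *; [exact: eqv_refl|apply: eqv_trans; eassumption| |exact: eqv_cons].
by apply: eqv_sq; apply: (sq_swap HX).
Qed.

Lemma eqv_size l m : eqv l m -> size l = size m.
Proof. by elim=> //= *; [apply: etrans; eassumption|congr S]. Qed.

Lemma eqv_last l m : eqv l m -> forall x, last x l = last x m.
Proof. by elim=> //= {}l {}m r _ H1 _ H2 x; rewrite H1. Qed.

(** Normal form of an equivalence of [x :: p] and [x :: q]: equivalent tails, or exactly one swap at
    the head between equivalences of the tails. *)
Definition joined x p q : Prop := eqv p q \/
  exists y z w r, [/\ sq x y z w, eqv p (y :: w :: r) & eqv q (z :: w :: r)].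

Definition joined_cons l m : Prop :=
  match l, m with
  | [::], [::] => True
  | x :: p, x' :: q => x = x' /\ joined x p q
  | _, _ => False
  end.

(* Transitivity of [joined] is where the flag condition enters: two squares at [x] sharing the edge
   [x y1] are completed to a 3-cube by the square obtained inductively at [y1]. *)
Lemma eqv_joined_cons l m : eqv l m -> joined_cons l m.
Proof.
have [n] := ubnP (size l); elim: n l m => // n IH l m ltn e.
elim: e ltn => {l m} [l|m l r e1 IH1 e2 IH2|x y z w l S|x l m e _] ltn.
- by case: l ltn => //= x l _; split=> //; left; exact: eqv_refl.
- move: IH1 IH2 => /(_ ltn) IH1; rewrite -(eqv_size e1) => /(_ ltn).
  have {e1} := eqv_size e1; have {e2} := eqv_size e2.
  case: l m r IH1 ltn => [|x l] [|x1 m] [|x2 r] //= [<- J1] ltn szm szl [<- J2].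
  split=> //; case: J1 => [E1|[y0 [y1 [w0 [r0 [S0 E0 E1]]]]]].
    case: J2 => [E2|[y0 [y1 [w0 [r0 [S0 E0 E2]]]]]]; first by left; apply: eqv_trans E2.
    by right; exists y0, y1, w0, r0; split=> //; apply: eqv_trans E0.
  case: J2 => [E2|[y1' [y2 [w1 [r1 [S1 E1' E2]]]]]].
    by right; exists y0, y1, w0, r0; split=> //; apply: eqv_trans E1; apply: eqv_sym.
  have E : eqv (y1 :: w0 :: r0) (y1' :: w1 :: r1) by apply: eqv_trans E1'; apply: eqv_sym.
  have [|eqy J] := IH _ _ _ E.
    by have := eqv_size E1; move: szl => /=; lia.
  subst y1'.
  (* Equivalent tails at [y1] force [w0 = w1], so the two squares share three corners and [y0 = y2].
     Otherwise [S2] is a third square at [y1] and the 3-cube exists. *)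
  case: J => [J|[a [b [u [s [S2 Ea Eb]]]]]].
    have [|eqw _] := IH _ _ _ J.
      by have := eqv_size E1; move: szl => /=; lia.
    subst w1.
    have eqy : y0 = y2.
      by apply: (sq_uniq HX (sq_swap HX (sq_turn HX (sq_swap HX S0))) (sq_swap HX (sq_turn HX S1))).
    subst y2; left; apply: eqv_trans E0 _; apply: eqv_trans (eqv_sym E2).
    by apply: eqv_cons.
  have szr0 := eqv_size E1; have szE := eqv_size E; have := szl; have := szm.
  move=> /= [szm'] [szl']; rewrite /= in szr0 szE.
  have [|eqa _] := IH _ _ _ Ea; first by rewrite /=; lia.
  have [|eqb _] := IH _ _ _ Eb; first by rewrite /=; lia.
  subst a b.
  have [v [T1 T2 T3]] := cube_condition HX (sq_turn HX (sq_swap HX S0)) (sq_turn HX S1) S2.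
  right; exists y0, y2, v, (u :: s); split=> //.
    apply: eqv_trans E0 _; apply: eqv_trans (eqv_cons _ Ea) _.
    by apply: eqv_sq; exact: (sq_turn HX).
  apply: eqv_trans E2 _; apply: eqv_trans (eqv_cons _ Eb) _.
  by apply: eqv_sq; exact: (sq_turn HX).
- by split=> //; right; exists y, z, w, l; split=> //; exact: eqv_refl.
- by split=> //; left.
Qed.

Lemma eqv_consl x p m : eqv (x :: p) m -> exists2 q, m = x :: q & joined x p q.
Proof. by move=> /eqv_joined_cons; case: m => //= y q [<- J]; exists q. Qed.

Lemma eqv_head x y p q : eqv (x :: p) (y :: q) -> x = y.
Proof. by case/eqv_consl => r [->]. Qed.

(** A head swap would make the two second vertices opposite corners of a square, hence distinct. *)
Lemma eqv_cancel x x' y p q : eqv (x :: y :: p) (x' :: y :: q) -> eqv (y :: p) (y :: q).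
Proof.
case/eqv_consl => _ [_ <-] [//|[a [b [w [r [S E1 E2]]]]]].
by case: (sq_neq HX S); rewrite -(eqv_head E1) -(eqv_head E2).
Qed.

(** * Reduced walks *)

Definition backtracks l : Prop := exists a b x y, l = a ++ x :: y :: x :: b.
Definition reduced l : Prop := forall m, eqv l m -> ~ backtracks m.

Lemma reduced_eqv l m : eqv l m -> reduced l -> reduced m.
Proof. by move=> e R r E; apply: R; apply: eqv_trans E. Qed.

Lemma reduced_behead x l : reduced (x :: l) -> reduced l.
Proof.
move=> R m E [a [b [y [z Em]]]]; apply: (R (x :: m)); first exact: eqv_cons.
by exists (x :: a), b, y, z; rewrite Em.
Qed.

Lemma not_reduced_back x y p : ~ reduced (x :: y :: x :: p).
Proof. by move=> /(_ _ (eqv_refl _)); case; exists [::], p, x, y. Qed.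

(** Up to swaps, moving from the head of [l] to [y] undoes the first step of [l]. *)
Definition descends l y : Prop := exists x q, eqv l (x :: y :: q).

(** A backtrack in a walk equivalent to [y :: l] lies at the head, where it makes [l] descend to [y]
    or backtrack, or behind the head, where a head swap leads to a shorter walk and induction
    applies. *)
Lemma reduced_cons y l : reduced l -> ~ descends l y -> reduced (y :: l).
Proof.
have [n] := ubnP (size l); elim: n l y => // n IH l y ltn R D m E.
have := E; case/eqv_consl => m' -> J [a [b [s [t Em]]]].
case: a Em => [|s' a] /= [].
  move=> <- Em'; rewrite {m'}Em' in J.
  case: J => [E1|[x1 [x [w [r [S E1 E2]]]]]].
    by apply: D; exists t, b.
  have eqt := eqv_head E2; subst t.
  have [q [eqr J]] := eqv_consl E2; subst q.
  case: J => [E3|[y' [w' [u [r' [S2 E3 E4]]]]]].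
    have := sq_neq HX (sq_turn HX S); by rewrite (eqv_head E3).
  have ? := eqv_head E3; have ? := eqv_head E4; subst y' w'.
  have equ : u = x1.
    by apply: (sq_uniq HX S2); apply: (sq_turn HX); apply: (sq_swap HX).
  subst u; apply: (@not_reduced_back x1 w r'); apply: reduced_eqv R.
  by apply: eqv_trans E1 _; apply: eqv_cons.
move=> _ Em'; case: J => [E1|[x [z [w [r [S E1 E2]]]]]].
  by apply: (R _ E1); exists a, b, s, t.
have R1 : reduced (w :: r) by apply: (@reduced_behead x); apply: reduced_eqv R.
have szl := eqv_size E1; rewrite /= in szl.
(* If [w :: r] descends to [z], swapping [w] for [y] in the same square makes [l] descend to [y];
   otherwise induction makes [z :: w :: r] reduced. *)
case: (pselect (descends (w :: r) z)) => [[w' [q E3]]|D1].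
  have ? := eqv_head E3; subst w'.
  apply: D; exists x, (z :: q); apply: eqv_trans E1 _; apply: eqv_trans (eqv_cons _ E3) _.
  by apply: eqv_sq; apply: (sq_swap HX); apply: (sq_turn HX).
have R2 : reduced (z :: w :: r) by apply: IH => //=; lia.
by apply: (R2 m' (eqv_sym E2)); exists a, b, s, t.
Qed.

(* The action of a vertex [y] on reduced walks ending (at their head) at a neighbour of [y]: it is
   well defined modulo [eqv] and respects the elementary homotopies, so simple connectivity makes
   reduced walks unique up to swaps (van der Waerden's trick). *)
Definition act l y : seq X :=
  if pselect (descends l y) is left H then y :: projT1 (cid (projT2 (cid H))) else y :: l.

Lemma act_descends x y l q : eqv l (x :: y :: q) -> eqv (act l y) (y :: q).
Proof.
move=> E; rewrite /act; case: pselect => [H|[]]; last by exists x, q.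
case: cid => x' H' /=; case: cid => q' /= E'.
by apply: (@eqv_cancel x' x); apply: eqv_trans E; apply: eqv_sym.
Qed.

Lemma act_ascends l y : ~ descends l y -> act l y = y :: l.
Proof. by rewrite /act; case: pselect. Qed.

Lemma descends_eqv l m y : eqv l m -> descends l y -> descends m y.
Proof. by move=> E [x [q E']]; exists x, q; apply: eqv_trans E'; apply: eqv_sym. Qed.

Lemma act_eqv l m y : eqv l m -> eqv (act l y) (act m y).
Proof.
move=> E; case: (pselect (descends l y)) => [[x [q E1]]|D].
  apply: eqv_trans (act_descends E1) _; apply/eqv_sym/act_descends.
  by apply: eqv_trans E1; apply: eqv_sym.
rewrite !act_ascends //; first exact: eqv_cons.
by move=> D'; apply: D; apply: descends_eqv D'; apply: eqv_sym.
Qed.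

Lemma act_reduced l y : reduced l -> reduced (act l y).
Proof.
move=> R; case: (pselect (descends l y)) => [[x [q E]]|D].
  apply: reduced_eqv (eqv_sym (act_descends E)) _; apply: (@reduced_behead x).
  exact: reduced_eqv R.
by rewrite act_ascends //; exact: reduced_cons.
Qed.

Lemma act_head l y : exists q, act l y = y :: q.
Proof. by rewrite /act; case: pselect => [H|H]; eexists. Qed.

(** Invariance under removal of a backtrack: a descent to [y] followed by a descent to [x] would
    make [x :: p] equivalent to a backtracking walk. *)
Lemma act_back x p y : reduced (x :: p) -> eqv (act (act (x :: p) y) x) (x :: p).
Proof.
move=> R; case: (pselect (descends (x :: p) y)) => [[x' [q E]]|D]; last first.
  by rewrite (act_ascends D); apply: (@act_descends y); exact: eqv_refl.
have ? := eqv_head E; subst x'.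
apply: eqv_trans (act_eqv _ (act_descends E)) _; rewrite act_ascends; first exact: eqv_sym.
case=> y' [r E']; have ? := eqv_head E'; subst y'.
apply: (@not_reduced_back x y r); apply: reduced_eqv R.
by apply: eqv_trans E _; apply: eqv_cons.
Qed.

(** Invariance under a swap, by cases on which of [y] and [z] shorten the walk. *)
Lemma act_sq x y z w p : sq x y z w -> reduced (x :: p) ->
  eqv (act (act (x :: p) y) w) (act (act (x :: p) z) w).
Proof.
move=> S R.
have S' := sq_swap HX S.
have main y' z' : sq x y' z' w -> ~ descends (x :: p) z' ->
    eqv (act (act (x :: p) y') w) (act (act (x :: p) z') w).
  move=> {S' y z} {}S D.
  rewrite (act_ascends D).
  case: (pselect (descends (x :: p) y')) => [[x' [q E]]|D1].
    have ? := eqv_head E; subst x'.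
    have E1 : eqv (z' :: x :: p) (z' :: w :: y' :: q).
      apply: eqv_trans (eqv_cons _ E) _; apply: eqv_sq.
      by apply: (sq_turn HX); apply: (sq_swap HX).
    apply: eqv_trans (act_eqv _ (act_descends E)) _; apply: eqv_sym.
    apply: eqv_trans (act_descends E1) _; rewrite act_ascends; first exact: eqv_refl.
    case=> y1 [r E2]; have ? := eqv_head E2; subst y1; apply: D.
    exists x, (w :: r); apply: eqv_trans E _; apply: eqv_trans (eqv_cons _ E2) _.
    exact: eqv_sq.
  rewrite (act_ascends D1).
  (* When neither shortens it, [w] does not either: by the normal form, a descent from [a] to [w]
     would give a descent from [x] to [b]. *)
  have N a b : sq x a b w -> ~ descends (x :: p) b -> ~ descends (a :: x :: p) w.
    move=> S1 Db [a' [q E]]; have ? := eqv_head E; subst a'; have [_ [<-] J] := eqv_consl E.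
    case: J => [E1|[x' [w' [u [r [S2 E1 E2]]]]]].
      have S3 := sq_turn HX S1.
      by case: (sq_neq HX S3); rewrite (eqv_head E1).
    have ? := eqv_head E1; have ? := eqv_head E2; subst x' w'.
    have equ : u = b by exact: (sq_uniq HX S2 (sq_turn HX S1)).
    by subst u; apply: Db; exists x, r.
  rewrite !act_ascends; [|apply: N D1; exact: (sq_swap HX)|exact: N D].
  by apply: eqv_sq; apply: (sq_turn HX); apply: (sq_swap HX); apply: (sq_turn HX).
(* When both shorten it, the normal form gives a square on [x], [y], [z], whose fourth corner is
   [w], and both routes descend to the same walk. *)
case: (pselect (descends (x :: p) z)) => [[x' [q E]]|]; last exact: main.
case: (pselect (descends (x :: p) y)) => [[x'' [r E']]|D]; last by apply/eqv_sym/main.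
have ? := eqv_head E; have ? := eqv_head E'; subst x' x''.
have : eqv (x :: y :: r) (x :: z :: q) by apply: eqv_trans E; apply: eqv_sym.
case/eqv_consl => _ [<-] [E1|[y' [z' [u [s [S1 E1 E2]]]]]].
  by case: (sq_neq HX S); rewrite (eqv_head E1).
have ? := eqv_head E1; have ? := eqv_head E2; subst y' z'.
have ? : u = w by apply: (sq_uniq HX S1).
subst u.
apply: eqv_trans (act_eqv _ (act_descends E')) _.
apply: eqv_trans (act_descends E1) _; apply: eqv_sym.
apply: eqv_trans (act_eqv _ (act_descends E)) _.
exact: act_descends E2.
Qed.

(** * Evaluation of walks and homotopy invariance *)

Definition ev l : seq X := foldr (fun y m => act m y) [::] l.

Lemma ev_reduced l : reduced (ev l).
Proof.
elim: l => [m /eqv_size|x l IH] /=; last exact: act_reduced.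
by case: m => // _ [[|? ?] [b [x [y]]]].
Qed.

Lemma ev_of_reduced l : reduced l -> eqv (ev l) l.
Proof.
elim: l => [_|x l IH R]; first exact: eqv_refl.
apply: eqv_trans (act_eqv _ (IH (reduced_behead R))) _.
rewrite act_ascends; first exact: eqv_refl.
move=> [y [q E]]; apply: (@not_reduced_back x y q); apply: reduced_eqv R.
exact: eqv_cons.
Qed.

Lemma ev_cat a l m : eqv (ev l) (ev m) -> eqv (ev (a ++ l)) (ev (a ++ m)).
Proof. by move=> E; elim: a => //= x a IH; apply: act_eqv. Qed.

Lemma ev_hstep l m : hstep l m -> eqv (ev l) (ev m).
Proof.
case=> [[a [b [x [y [_ [-> ->]]]]]]|[a [b [c [Hc [-> ->]]]]]]; apply: ev_cat => /=.
  have [q Eq] := act_head (ev b) x; rewrite Eq; apply: act_back.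
  by rewrite -Eq; exact: (@ev_reduced (x :: b)).
have [q Eq] := act_head (ev b) (c (pt2 true true)); rewrite Eq; apply: act_sq.
  apply: (sq_turn HX); apply: (sq_swap HX); apply: (sq_turn HX); by exists c.
by rewrite -Eq; exact: (@ev_reduced (_ :: b)).
Qed.

Lemma ev_homotopic l m : homotopic l m -> eqv (ev l) (ev m).
Proof.
elim=> [? ? /ev_hstep|?|? ? _ /eqv_sym|? ? ? _ H _] //; first exact: eqv_refl.
exact: eqv_trans.
Qed.

Lemma homotopic_cat a l m b : homotopic l m -> homotopic (a ++ l ++ b) (a ++ m ++ b).
Proof.
elim=> [{}l {}m H|?|? ? _ H|? ? ? _ H1 _ H2];
  [|exact: rst_refl|exact: rst_sym|exact: rst_trans H1 H2].
apply: rst_step; case: H => [[a' [b' [x [y [A [-> ->]]]]]]|[a' [b' [c [Hc [-> ->]]]]]].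
  by left; exists (a ++ a'), (b' ++ b), x, y; split=> //; rewrite -!catA.
by right; exists (a ++ a'), (b' ++ b), c; split=> //; rewrite -!catA.
Qed.

Lemma walk_cons x y p : walk (x :: y :: p) <-> adj x y /\ walk (y :: p).
Proof.
split=> [H|[? ?]]; last exact: walkS.
by inversion H.
Qed.

Lemma walk_cat x p q : walk (x :: p) -> walk (last x p :: q) -> walk (x :: p ++ q).
Proof.
elim: p x => //= y p IH x /walk_cons[A W] W'.
by apply: walkS => //; exact: IH.
Qed.

Lemma walk_rev x p : walk (x :: p) -> walk (rev (x :: p)).
Proof.
elim: p x => [x _|y p IH x /walk_cons[A /IH]]; first exact: walk1.
rewrite [rev (x :: _)]rev_cons -cats1; case E : (rev (y :: p)) => [|z s] W.
  by move/(congr1 size): E; rewrite size_rev.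
rewrite cat_cons; apply: walk_cat => //.
have -> : last z s = y.
  by rewrite -[last z s]/(last y (z :: s)) -E rev_cons last_rcons.
by apply: walkS (walk1 _); exact: (adjC HX).
Qed.

(** With [s] the reverse of [q], the walk [p], [s], [q] contracts to [q] through the closed walk
    [p], [s] and to [p] through the closed walk [s], [q]. *)
Lemma walks_homotopic x p q : walk (x :: p) -> walk (x :: q) ->
  last x p = last x q -> homotopic (x :: p) (x :: q).
Proof.
move=> Wp Wq El; have Wr := walk_rev Wq.
case E : (rev (x :: q)) Wr => [|o s] Wr.
  by move/(congr1 size): E; rewrite size_rev.
have Eo : o = last x q.
  have : x :: q = rev (o :: s) by rewrite -E revK.
  by move=> /(congr1 (last x)); rewrite rev_cons last_rcons => <-.
have Ex : last o s = x.
  by rewrite -[last o s]/(last x (o :: s)) -E rev_cons last_rcons.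
have SC y r : walk (y :: r) -> last y r = y -> homotopic (y :: r) [:: y].
  by case: HX => _ _ [_ _]; exact.
have H1 : homotopic (x :: p ++ s) [:: x].
  by apply: SC; [apply: walk_cat; rewrite // El -Eo|rewrite last_cat El -Eo].
have H2 : homotopic (o :: s ++ q) [:: o].
  by apply: SC; [apply: walk_cat; rewrite // Ex|rewrite last_cat Ex -Eo].
apply: (@rst_trans _ _ _ (x :: p ++ s ++ q)); last first.
  by have := homotopic_cat [::] q H1; rewrite /= -catA.
apply: rst_sym; have := homotopic_cat (belast x p) [::] H2; rewrite !cats0.
by rewrite cats1 -cat_rcons Eo -El -lastI.
Qed.

(** Evaluation is homotopy invariant and fixes reduced walks up to swaps. *)
Lemma reduced_walks_eqv x p q : walk (x :: p) -> walk (x :: q) -> last x p = last x q ->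
  reduced (x :: p) -> reduced (x :: q) -> eqv (x :: p) (x :: q).
Proof.
move=> Wp Wq El Rp Rq.
apply: eqv_trans (eqv_sym (ev_of_reduced Rp)) _; apply: eqv_trans (ev_of_reduced Rq).
by apply: ev_homotopic; exact: walks_homotopic.
Qed.

Lemma walk_eqv l m : eqv l m -> walk l -> walk m.
Proof.
elim=> {l m} [//|m l r _ H1 _ H2 /H1/H2//|x y z w l S|x l m E IH].
  move=> /walk_cons[_] W; have S' := sq_turn HX (sq_swap HX S).
  apply: walkS; first exact: sq_adj (sq_swap HX S).
  case: l W => [|v l] /walk_cons[_ W]; apply: walkS => //.
    exact: sq_adj (sq_swap HX S').
  exact: sq_adj (sq_swap HX S').
case: l E IH => [|y l] E IH; first by have := eqv_size E; case: m {IH E}.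
by move=> /walk_cons[A /IH W]; have [q Em _] := eqv_consl E; subst m; apply: walkS.
Qed.

End Walks.

(** * Distance and hyperplanes *)

Section Hyperplanes.
Variable X : CubeData.
Hypothesis HX : CAT0 X.
Implicit Types (a b c o s t u v w x y z : X) (p q r l m : seq X) (e f h : X * X).

Lemma chain_walk n x y : chain (@adj X) n x y ->
  exists p, [/\ walk (x :: p), last x p = y & size p <= n].
Proof.
elim=> {n x y} [n x|n x y z A _ [p [W L S]]]; first by exists [::]; split=> //; exact: walk1.
by exists (y :: p); split=> //; exact: walkS.
Qed.

Lemma walk_chain n x p : walk (x :: p) -> size p <= n -> chain (@adj X) n x (last x p).
Proof.
elim: p n x => [|y p IH] n x /=; first by move=> *; exact: chain0.
by case: n => // n /walk_cons[A W] le; apply: chainS A _; exact: IH.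
Qed.

Lemma chain_leq (T : Type) (R : T -> T -> Prop) (n k : nat) (x y : T) :
  n <= k -> chain R n x y -> chain R k x y.
Proof.
move=> le C; elim: C k le => {n x y} [n x|n x y z A _ IH] k; first by move=> _; exact: chain0.
by case: k => // k le; apply: chainS A _; exact: IH.
Qed.

Lemma connected x y : exists n, `[< chain (@adj X) n x y >].
Proof.
by case: HX => _ _ [_ /(_ x y)[n C] _]; exists n; apply/asboolP.
Qed.

Definition dist x y : nat := ex_minn (connected x y).

Lemma chain_dist n x y : chain (@adj X) n x y <-> dist x y <= n.
Proof.
rewrite /dist; case: ex_minnP => m /asboolP C min; split; last by move=> le; exact: chain_leq C.
by move=> C'; apply: min; apply/asboolP.
Qed.

Lemma walk_dist x p : walk (x :: p) -> dist x (last x p) <= size p.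
Proof. by move=> W; apply/chain_dist; exact: walk_chain. Qed.

Lemma distxx x : dist x x = 0.
Proof. by apply/eqP; rewrite -leqn0; apply/chain_dist; exact: chain0. Qed.

Lemma dist0 x y : dist x y = 0 -> x = y.
Proof.
move=> E; have /chain_walk[p [_ <-]] : chain (@adj X) 0 x y by apply/chain_dist; rewrite E.
by case: p.
Qed.

Lemma dist_le_sym x y : dist x y <= dist y x.
Proof.
have /chain_walk[p [W L S]] : chain (@adj X) (dist y x) y x by apply/chain_dist.
have := walk_rev HX W; case E : (rev (y :: p)) => [|z q] W'.
  by move/(congr1 size): E; rewrite size_rev.
have Ez : z = x.
  have : y :: p = rev (z :: q) by rewrite -E revK.
  by move=> /(congr1 (last y)); rewrite rev_cons last_rcons /= L.
have Ey : last z q = y by rewrite -[last z q]/(last y (z :: q)) -E rev_cons last_rcons.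
have := walk_dist W'; rewrite Ey Ez; move/(congr1 size): E; rewrite size_rev /=.
lia.
Qed.

Lemma dist_sym x y : dist x y = dist y x.
Proof. by apply/eqP; rewrite eqn_leq !dist_le_sym. Qed.

Lemma dist_tri y x z : dist x z <= dist x y + dist y z.
Proof.
have /chain_walk[p [W L S]] : chain (@adj X) (dist x y) x y by apply/chain_dist.
have /chain_walk[q [W' L' S']] : chain (@adj X) (dist y z) y z by apply/chain_dist.
have := @walk_dist x (p ++ q); rewrite last_cat L L' size_cat => H.
apply: leq_trans (H _) _; last by rewrite leq_add.
by apply: walk_cat => //; rewrite L.
Qed.

Definition geo x o p : Prop := [/\ walk (x :: p), last x p = o & size p = dist x o].

Lemma geo_ex x o : exists p, geo x o p.
Proof.
have /chain_walk[p [W L S]] : chain (@adj X) (dist x o) x o by apply/chain_dist.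
exists p; split=> //; have := walk_dist W; rewrite L; lia.
Qed.

Lemma walk_unback l x y r : walk (l ++ x :: y :: x :: r) -> walk (l ++ x :: r).
Proof.
elim: l => [|z l IH] /=; first by move=> /walk_cons[_ /walk_cons[]].
case: l IH => [|z' l] /= IH /walk_cons[A W]; apply: walkS => //; exact: IH.
Qed.

(** Swaps keep length and endpoints, and cutting out a backtrack would shorten the walk. *)
Lemma geo_reduced x o p : geo x o p -> reduced (x :: p).
Proof.
move=> [W L S] m E [l [r [y [z Em]]]].
have Wm := walk_eqv HX E W; have sz := eqv_size E.
have El : last x m = o by rewrite -(eqv_last E x).
have [q Eq _] := eqv_consl HX E; rewrite Em in Wm Eq El sz.
have := walk_unback Wm; case El' : (l ++ y :: r) => [|x' q'].
  by case: (l) El'.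
have Ex : x' = x by case: (l) El' Eq => /= [|? ?] [-> _] [->].
move=> /walk_dist.
have -> : last x' q' = o.
  by rewrite -[last x' q']/(last x (x' :: q')) -El' -El !last_cat.
move: sz (congr1 size El'); rewrite Ex !size_cat /= -S; lia.
Qed.

Lemma reduced_size x o p : walk (x :: p) -> last x p = o -> reduced (x :: p) ->
  size p = dist x o.
Proof.
move=> W L R; have [q G] := geo_ex x o; have Rq := geo_reduced G.
case: G => Wq Lq <-; have := eqv_size (reduced_walks_eqv HX W Wq _ R Rq).
by rewrite L Lq => /(_ erefl) [].
Qed.

(** A geodesic from [x] to [o] either descends to [y] or stays reduced when [y] is prepended, and
    reduced walks are geodesic. *)
Lemma dist_adj o x y : adj x y ->
  dist x o = (dist y o).+1 \/ dist y o = (dist x o).+1.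
Proof.
move=> A; have [p G] := geo_ex x o; have R := geo_reduced G; case: G => W L S.
case: (pselect (descends (x :: p) y)) => [[x' [q E]]|D].
  have ? := eqv_head HX E; subst x'; left.
  have /walk_cons[_ W'] := walk_eqv HX E W.
  rewrite -S -(@reduced_size y o q) //; first by have [->] := eqv_size E.
    by rewrite -L; have /= := eqv_last E x.
  by apply: (@reduced_behead _ x); apply: reduced_eqv R.
right; rewrite -(@reduced_size y o (x :: p)) /= ?S //.
  by apply: walkS => //; exact: (adjC HX).
by apply: (reduced_cons HX).
Qed.

Lemma dist_adjr o x y : adj x y ->
  dist o x = (dist o y).+1 \/ dist o y = (dist o x).+1.
Proof. by rewrite ![dist o _]dist_sym; exact: dist_adj. Qed.

Lemma adj_dist1 x y : adj x y -> dist x y = 1.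
Proof. by move=> /(dist_adj y); rewrite distxx; case. Qed.

Lemma descent x y : x <> y -> exists2 x', adj x x' & dist x y = (dist x' y).+1.
Proof.
have [[|x' p] [W L S]] := geo_ex x y; first by case: (dist0 (esym S)).
move=> _; move/walk_cons: W => [A W]; exists x' => //.
have := walk_dist W; have := dist_adj y A; rewrite -S -[last x' p]/(last x (x' :: p)) L /=.
lia.
Qed.

(** The geodesics to [o] through [y] and through [z] are reduced, hence equivalent, and the normal
    form at [x] yields the square. *)
Lemma quadrangle o x y z : adj x y -> adj x z -> y <> z ->
  dist x o = (dist y o).+1 -> dist x o = (dist z o).+1 ->
  exists2 w, sq x y z w & dist y o = (dist w o).+1.
Proof.
move=> Ay Az N Ey Ez.
have G u p : adj x u -> dist x o = (dist u o).+1 -> geo u o p -> geo x o (u :: p).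
  by move=> A E [W L S]; split=> //=; [exact: walkS|rewrite E S].
have [p Gp] := geo_ex y o; have [q Gq] := geo_ex z o.
have Gp' := G _ _ Ay Ey Gp; have Gq' := G _ _ Az Ez Gq.
have Rp := geo_reduced Gp; have Rq := geo_reduced Gq'; have Rp' := geo_reduced Gp'.
case: Gp Gp' Gq' => Wp Lp Sp [Wp' Lp' Sp'] [Wq' Lq' Sq'].
have := reduced_walks_eqv HX Wp' Wq' _ Rp' Rq; rewrite Lp' Lq' => /(_ erefl).
move=> /(eqv_consl HX)[_ [<-]] [/(eqv_head HX)//|[y' [z' [w [r [S E1 E2]]]]]].
have ? := eqv_head HX E1; have ? := eqv_head HX E2; subst y' z'.
exists w => //; have /walk_cons[_ W] := walk_eqv HX E1 Wp.
have [sz] := eqv_size E1.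
rewrite -Sp sz /= (@reduced_size w o r) //.
  by have := eqv_last E1 y; rewrite /= Lp.
by apply: (@reduced_behead _ y); apply: reduced_eqv Rp.
Qed.

(* [sd e x]: the vertex [x] lies in the halfspace of the hyperplane dual to [e] containing [e.1]. *)
Definition sd e x : bool := dist x e.1 < dist x e.2.
Definition sep e x y : bool := sd e x != sd e y.

Lemma sepC e x y : sep e x y = sep e y x.
Proof. by rewrite /sep eq_sym. Qed.

(** Otherwise [a] and [w] would both be closer to [x] than [b], and the quadrangle condition at [b]
    would make the fourth corner [c] closer still. *)
Lemma sd_sq x a b c w : sq a b c w -> sd (a, b) x -> sd (c, w) x.
Proof.
move=> S; have Aab := sq_adj HX S; have Aac := sq_adj HX (sq_swap HX S).
have S' := sq_turn HX S; have Abd := sq_adj HX (sq_swap HX S').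
have Acw : adj c w := sq_adj HX (sq_swap HX (sq_turn HX (sq_swap HX S))).
rewrite /sd /= => lt; case: ltnP => // le.
have := dist_adjr x Aab; have := dist_adjr x Aac; have := dist_adjr x Abd.
have := dist_adjr x Acw => ? ? ? ?.
have [||||w' S'' Ew] := @quadrangle x b a w _ Abd.
- exact: (adjC HX).
- exact: (sq_neq HX S').
- by rewrite ![dist _ x]dist_sym; lia.
- by rewrite ![dist _ x]dist_sym; lia.
have Ec := sq_uniq HX S'' S'; rewrite Ec ![dist _ x]dist_sym in Ew; lia.
Qed.

Lemma sd_flip a b x : adj a b -> sd (b, a) x = ~~ sd (a, b) x.
Proof. by move=> /(dist_adjr x); rewrite /sd /=; lia. Qed.

(** Stated with [sep] because [theta] also reverses edges, which exchanges the values of [sd]. *)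
Lemma theta_sep_aux e f : theta e f ->
  (is_edge e <-> is_edge f) /\ (is_edge e -> sep e =2 sep f).
Proof.
elim=> {e f} [e f [[c [Hc [-> ->]]]|->]|e|e f _ [H1 H2]|e f h _ [H1 H2] _ [H3 H4]].
- have S : sq (c (pt2 false false)) (c (pt2 true false)) (c (pt2 false true)) (c (pt2 true true)).
    by exists c.
  have S' := sq_swap HX (sq_turn HX (sq_swap HX S)).
  split; first by split=> _; [exact: sq_adj S'|exact: sq_adj S].
  move=> _ x y; rewrite /sep.
  have E z : sd (c (pt2 false false), c (pt2 true false)) z =
             sd (c (pt2 false true), c (pt2 true true)) z.
    by apply/idP/idP; apply: sd_sq.
  by rewrite !E.
- split; first by split; exact: (adjC HX).
  case: e => a b A x y; rewrite /sep !(sd_flip _ A) /=; by do 2 case: sd.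
- by split.
- by split; [exact: iff_sym|move=> /H1 E x y; rewrite H2].
- split; first exact: iff_trans H1 H3.
  by move=> E x y; rewrite H2 // H4 //; apply/H1.
Qed.

Lemma theta_edge e f : theta e f -> is_edge e -> is_edge f.
Proof. by move=> /theta_sep_aux[H _] /H. Qed.

Lemma theta_sep e f : theta e f -> is_edge e -> sep e =2 sep f.
Proof. by move=> /theta_sep_aux[_ H]. Qed.

Lemma sd_fst e : is_edge e -> sd e e.1.
Proof. by move=> A; rewrite /sd distxx adj_dist1. Qed.

Lemma sd_snd e : is_edge e -> sd e e.2 = false.
Proof. by move=> A; rewrite /sd distxx. Qed.

(** Induction on the distance from [x] to [a]: after a step to [x'] towards [a], the quadrangle
    condition seen from [b] gives a square whose edge at [x'] opposite to [xy] again joins the two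
    sides. *)
Lemma sep_theta_aux a b x y : adj a b -> adj x y -> sd (a, b) x -> ~~ sd (a, b) y ->
  theta (a, b) (x, y).
Proof.
move=> Aab; move En : (dist x a) => n; rewrite /sd /=; elim: n x y En => [|n IH] x y En Axy Sx Sy.
  have := dist_adj a Axy; have := dist_adj b Axy; have := dist_adjr x Aab.
  have := dist_adjr y Aab; rewrite (dist0 En) distxx => ? ? ? ?.
  have -> : y = b by apply: dist0; lia.
  exact: rst_refl.
have nxa : x <> a by move=> E; rewrite E distxx in En.
have [x' Axx' Ex'] := descent nxa.
have := dist_adj a Axy; have := dist_adj b Axy; have := dist_adjr x Aab.
have := dist_adjr y Aab; have := dist_adj b Axx'; have := dist_adjr x' Aab => ? ? ? ? ? ?.
have [||||w S Ew] := @quadrangle b x x' y _ Axy => //; try lia.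
  by move=> E; move: Ex'; rewrite E; lia.
have Ax'w := sq_adj HX (sq_swap HX (sq_turn HX S)).
have Ayw := sq_adj HX (sq_swap HX (sq_turn HX (sq_swap HX S))).
have := dist_adj a Ax'w; have := dist_adj a Ayw; have := dist_adj b Ayw => ? ? ?.
apply: (@rst_trans _ _ _ (x', w)).
  by apply: IH => //; lia.
apply: rst_sym; apply: rst_step; left; have [c [Hc [<- <- <- <-]]] := sq_swap HX S.
by exists c.
Qed.

Lemma sep_theta e x y : is_edge e -> adj x y -> sep e x y -> theta e (x, y).
Proof.
case: e => a b A Axy; rewrite /sep.
case Ex : (sd _ x); case Ey : (sd _ y) => // _.
  by apply: sep_theta_aux => //; rewrite Ey.
apply: (@rst_trans _ _ _ (y, x)); last by apply: rst_step; right.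
by apply: sep_theta_aux; rewrite ?Ex //; exact: (adjC HX).
Qed.

(** The sides of [h] can be measured along any dual edge, here [vv']. *)
Lemma mate_lt h v v' z : is_edge h -> adj v v' -> sep h v v' -> sd h z = sd h v ->
  dist z v' = (dist z v).+1.
Proof.
move=> E A S Ez; have T := sep_theta E A S.
have := theta_sep T E z v; rewrite {1}/sep Ez eqxx => /esym/negbFE/eqP.
by rewrite (@sd_fst (v, v')) // /sd /=; have := dist_adjr z A; lia.
Qed.

(** * Carriers, convexity and gates *)

Lemma in_carrierP h v : is_edge h ->
  in_carrier h v <-> exists2 v', adj v v' & sep h v v'.
Proof.
move=> E; split=> [[[a b] [T [/=<-|/=<-]]]|[v' A S]].
- have A := theta_edge T E; exists b => //.
  by rewrite (theta_sep T E) /sep (sd_fst A) (sd_snd A).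
- have A := theta_edge T E; exists a; first exact: (adjC HX).
  by rewrite (theta_sep T E) /sep (sd_fst A) (sd_snd A).
- by exists (v, v'); split; [exact: sep_theta|left].
Qed.

Definition conv (N : X -> Prop) : Prop := forall u v t, N u -> N v -> adj u t ->
  dist u v = (dist t v).+1 -> N t.

(** A step across the hyperplane leads away from every vertex on the side it leaves. *)
Lemma halfspace_conv e (b : bool) : is_edge e -> conv (fun x => sd e x = b).
Proof.
move=> E u v t Eu Ev A Ed; case S : (sep e u t); last by move/negbFE/eqP: S => <-.
have := @mate_lt e u t v E A S; rewrite Eu Ev => /(_ erefl).
by rewrite ![dist v _]dist_sym; lia.
Qed.

(** If [u], [v], [t] lie on one side, both [t] and the mate of [u] across [h] are closer than [u] to
    the mate of [v]; the quadrangle condition then gives an edge at [t] dual to [h]. *)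
Lemma carrier_conv h : is_edge h -> conv (in_carrier h).
Proof.
move=> E.
have same u v t : in_carrier h u -> in_carrier h v -> adj u t ->
    dist u v = (dist t v).+1 -> sd h t = sd h u -> sd h u = sd h v -> in_carrier h t.
  move=> /(in_carrierP _ E)[u' Au Su] /(in_carrierP _ E)[v' Av Sv] A Ed Et Euv.
  have E1 := mate_lt E Av Sv Euv.
  have E2 := mate_lt E Au Su (esym Euv).
  have E3 : dist t v' = (dist t v).+1 by apply: mate_lt Sv _; rewrite // Et.
  have E4 : dist u' v = (dist u' v').+1.
    apply: (@mate_lt h v' v u' E (adjC HX Av)); first by rewrite sepC.
    by move: Su Sv; rewrite /sep Euv; do 3 case: sd.
  rewrite [dist v u']dist_sym [dist v u]dist_sym in E2.
  have [|||w S _] := @quadrangle v' u u' t Au A => //; try lia.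
    by move=> Eq; move: Su; rewrite /sep Eq Et eqxx.
  apply/(in_carrierP _ E); exists w.
    exact: sq_adj (sq_swap HX (sq_turn HX (sq_swap HX S))).
  have T := sep_theta E Au Su.
  have T' : theta h (t, w).
    apply: rst_trans T _; apply: rst_step; left; have [c [Hc [<- <- <- <-]]] := S.
    by exists c.
  have Atw := theta_edge T' E.
  by rewrite (theta_sep T' E) /sep (sd_fst Atw) (sd_snd Atw).
move=> u v t Nu Nv A Ed.
case St : (sep h u t).
  by apply/(in_carrierP _ E); exists u; [exact: (adjC HX)|rewrite sepC].
have Et : sd h t = sd h u by move/negbFE/eqP: St.
case: (eqVneq (sd h u) (sd h v)) => [Euv|Nuv]; first exact: (same u v).
(* If [v] lies on the other side, its mate [v'] takes its place. *)
have /(in_carrierP _ E)[v' Av Sv] := Nv.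
have Ev' : sd h u = sd h v' by move: Nuv Sv; rewrite /sep; do 3 case: sd.
have Sv' : sep h v' v by rewrite sepC.
have E1 := mate_lt E (adjC HX Av) Sv' Ev'.
have E2 := mate_lt E (adjC HX Av) Sv' (etrans Et Ev').
apply: (same u v') => //; last by lia.
by apply/(in_carrierP _ E); exists v; [exact: (adjC HX)|].
Qed.

Lemma conv_cross N e u v : conv N -> N u -> N v -> sep e u v ->
  exists s t, [/\ N s, N t, adj s t & sep e s t].
Proof.
move=> C; move En : (dist u v) => n; elim: n u En => [|n IH] u En Nu Nv S.
  by move: S; rewrite (dist0 En) /sep eqxx.
have nuv : u <> v by move=> Eq; rewrite Eq distxx in En.
have [t A Et] := descent nuv; have Nt := C _ _ _ Nu Nv A Et.
case St : (sep e u t); first by exists u, t.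
apply: (IH t) => //; first lia.
by move: S St; rewrite /sep; do 3 case: sd.
Qed.

(** A nearest vertex of a convex set is a gate. Induction on the distance from [u] to [v], looking
    at the last two steps [s'], [s], [v] of a geodesic from [u]. *)
Lemma conv_gate N x u : conv N -> N u -> (forall v, N v -> dist x u <= dist x v) ->
  forall v, N v -> dist x v = dist x u + dist u v.
Proof.
move=> C Nu Min v; move En : (dist u v) => n.
elim/ltn_ind: n v En => n IH v En Nv.
case: n IH En => [|n] IH En; first by rewrite (dist0 En) addn0.
have nvu : v <> u by move=> Eq; rewrite Eq distxx in En.
have [s Avs Es] := descent nvu; have Ns := C _ _ _ Nv Nu Avs Es.
rewrite ![dist _ u]dist_sym in Es.
have Eus : dist u s = n by lia.
have Exs := IH n (ltnSn n) s Eus Ns.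
have := dist_adjr x Avs; have := dist_tri u x v; rewrite Exs En.
case: n IH En Eus Exs => [|n] IH En Eus Exs; first by have := Min _ Nv; lia.
move=> tri [E|lt]; [by lia|exfalso].
have nsu : s <> u by move=> Eq; move: Es; rewrite Eq distxx; lia.
have [s' Ass' Es'] := descent nsu; have Ns' := C _ _ _ Ns Nu Ass' Es'.
rewrite ![dist _ u]dist_sym in Es'.
have Exs' : dist x s' = dist x u + n by apply: IH => //; lia.
have nvs' : v <> s' by move=> Eq; move: En; rewrite Eq; lia.
(* Otherwise [v] and [s'] are both closer to [x] than [s]; the fourth corner [t] lies in [N] by
   convexity, and its distance to [x] contradicts the induction hypothesis. *)
have [||t S Et] := @quadrangle x s v s' (adjC HX Avs) Ass' nvs';
  rewrite ?[dist _ x]dist_sym //; try lia.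
have Avt := sq_adj HX (sq_swap HX (sq_turn HX S)).
have As't := sq_adj HX (sq_swap HX (sq_turn HX (sq_swap HX S))).
have Nt : N t.
  apply: (C v s' t) => //; rewrite (adj_dist1 (adjC HX As't)).
  have := dist_adj s' Avt; rewrite (adj_dist1 (adjC HX As't)).
  by case=> // -[/esym/dist0].
have := dist_adjr u Avt; have := dist_tri s' u t; rewrite (adj_dist1 As't) => ? ?.
have := dist_adjr u As't => ?.
have Eut : dist u t = n.+1 by lia.
have := IH n.+1 (ltnSn _) t Eut Nt; rewrite ![dist _ x]dist_sym in Et; lia.
Qed.

Lemma geo_fun x u : exists f : nat -> X,
  [/\ f 0 = x, (forall i, i < dist x u -> adj (f i) (f i.+1))
    & forall i, i <= dist x u -> dist (f i) u = dist x u - i].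
Proof.
move En : (dist x u) => n; elim: n x En => [|n IH] x En.
  by exists (fun _ => x); split=> // -[|].
have nxu : x <> u by move=> Eq; rewrite Eq distxx in En.
have [x' A E] := descent nxu.
have [|f [f0 fA fd]] := IH x'; first lia.
exists (fun i => if i is j.+1 then f j else x); split=> //.
  by case=> [|i] /= lt; [rewrite f0|apply: fA].
by case=> [|i] /= le; [lia|rewrite fd //].
Qed.

Lemma geo_fun_dist x u (f : nat -> X) :
  (forall i, i < dist x u -> adj (f i) (f i.+1)) ->
  (forall i, i <= dist x u -> dist (f i) u = dist x u - i) ->
  forall i j, i + j <= dist x u -> dist (f i) (f (i + j)) = j.
Proof.
move=> fA fd i; have up j : i + j <= dist x u -> dist (f i) (f (i + j)) <= j.
  elim: j => [|j IH] le; first by rewrite addn0 distxx.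
  have := dist_tri (f (i + j)) (f i) (f (i + j.+1)).
  rewrite addnS (adj_dist1 (fA _ _)); last by lia.
  by have := IH; lia.
move=> j le; have := up j le; have := dist_tri (f (i + j)) (f i) u.
by rewrite !fd //; lia.
Qed.

(* The hyperplanes of [e] and [f] cross or coincide. *)
Definition straddles e f : Prop :=
  exists c1 c2, [/\ in_carrier e c1, in_carrier e c2 & sep f c1 c2].

Lemma straddles_contact e f : is_edge e -> is_edge f -> straddles e f -> contact e f.
Proof.
move=> Ee Ef [c1 [c2 [N1 N2 S]]]; split=> //; split=> //.
have [s [t [[e' [T Es]] _ A St]]] := conv_cross (carrier_conv Ee) N1 N2 S.
exists e', (s, t); split=> //; split; first exact: sep_theta.
by case: Es => ->; [left|right; right; left].
Qed.

(** All four quadrants of [e] and [f] are inhabited. Each halfspace of [f] is convex and meets both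
    sides of [e], so it contains an edge dual to [e]. *)
Lemma quadrants_straddle e f x1 x2 y1 y2 : is_edge e -> is_edge f ->
  sep f x1 x2 -> sep f y1 y2 -> sep e x1 y1 -> sep e x1 y2 -> sep e x2 y1 -> sep e x2 y2 ->
  straddles e f.
Proof.
move=> Ee Ef Sx Sy.
wlog Exy : y1 y2 Sy / sd f x1 = sd f y1.
  move=> H S1 S2 S3 S4; case: (eqVneq (sd f x1) (sd f y1)) => [Exy|Nxy]; first exact: (H y1 y2).
  apply: (H y2 y1) => //; first by rewrite sepC.
  by move: Sy Nxy; rewrite /sep; do 3 case: sd.
have Exy' : sd f x2 = sd f y2 by move: Sx Sy; rewrite /sep -Exy; do 3 case: sd.
move=> S1 _ _ S2.
have [s [t [Es _ A S]]] := conv_cross (halfspace_conv (b := sd f x1) Ef) erefl (esym Exy) S1.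
have [s' [t' [Es' _ A' S']]] := conv_cross (halfspace_conv (b := sd f x2) Ef) erefl (esym Exy') S2.
exists s, s'; split; [| |by rewrite /sep Es Es'].
  by apply/(in_carrierP _ Ee); exists t.
by apply/(in_carrierP _ Ee); exists t'.
Qed.

End Hyperplanes.

(** * Hyperplanes crossing a ray *)

Lemma bool_switch (b : nat -> bool) n : b 0 != b n -> exists2 i, i < n & b i != b i.+1.
Proof.
elim: n => [|n IH]; first by rewrite eqxx.
case: (eqVneq (b n) (b n.+1)) => [<- /IH[i lt S]|N _]; last by exists n.
by exists i => //; exact: ltnW.
Qed.

Lemma chain_sym (T : Type) (R : T -> T -> Prop) n x y :
  (forall x y, R x y -> R y x) -> chain R n x y -> chain R n y x.
Proof.
move=> sR; have snoc k a b c : chain R k a b -> R b c -> chain R k.+1 a c.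
  elim=> {k a b} [k a|k a b d A _ IH] B; first by apply: chainS B _; exact: chain0.
  by apply: chainS A _; exact: IH.
elim=> {n x y} [n x|n x y z A _ IH]; first exact: chain0.
by apply: snoc IH _; exact: sR.
Qed.

Lemma chain_nat (T : Type) (R : T -> T -> Prop) (s : nat -> T) i n :
  (forall k, R (s k) (s k.+1)) -> chain R n (s i) (s (i + n)).
Proof.
move=> Rs; elim: n i => [|n IH] i; first by rewrite addn0; exact: chain0.
by apply: chainS (Rs i) _; rewrite addnS -addSn.
Qed.

Lemma ltn_sorted_nth_add (s : seq nat) i j : sorted ltn s -> i + j < size s ->
  nth 0 s i + j <= nth 0 s (i + j).
Proof.
move=> Ss; elim: j => [|j IH] lt; first by rewrite !addn0.
have lt' : i + j < size s by lia.
have := sorted_ltn_nth ltn_trans 0 Ss (i + j) (i + j.+1); rewrite !inE => /(_ lt' lt).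
by have := IH lt'; lia.
Qed.

(** More than [t] elements lie between the first [p] and the last [p]; this leaves room for a
    stretch of length [t] of the ray. *)
Lemma ltn_sorted_drop (s : seq nat) p t m : sorted ltn s -> 0 < p -> 2 * p + t < size s ->
  m \in drop (size s - p) s -> (nth 0 s p.-1).+1 + t <= m.
Proof.
move=> Ss p0 big /(nthP 0)[i lti Em].
have {}lti : i < size s - (size s - p) by rewrite -size_drop.
have -> : m = nth 0 s (size s - p + i) by rewrite -Em nth_drop.
have E : p.-1 + (size s - p + i - p.-1) = size s - p + i by lia.
have := @ltn_sorted_nth_add s p.-1 (size s - p + i - p.-1) Ss; rewrite E.
have lt1 : size s - p + i < size s by lia.
by move=> /(_ lt1); lia.
Qed.

Lemma ltn_sorted_take (s : seq nat) p m : sorted ltn s -> p <= size s ->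
  m \in take p s -> m <= nth 0 s p.-1.
Proof.
move=> Ss le /(nthP 0)[i lti Em].
have {}lti : i < p by rewrite -(size_takel le).
have -> : m = nth 0 s i by rewrite -Em nth_take.
have E : i + (p.-1 - i) = p.-1 by lia.
have := @ltn_sorted_nth_add s i (p.-1 - i) Ss; rewrite E.
have lt1 : p.-1 < size s by lia.
by move=> /(_ lt1); lia.
Qed.

Section Ray.
Variable X : CubeData.
Hypothesis HX : CAT0 X.
Variable g : nat -> X.
Hypothesis Hg : geodesic_ray g.
Local Notation dist := (dist HX).
Local Notation sd := (sd HX).
Local Notation sep := (sep HX).
Local Notation straddles := (straddles HX).

Lemma Hy_edge i : is_edge (Hy g i).
Proof. by case: Hg => A _; exact: A. Qed.

Lemma ray_dist i j : dist (g i) (g (i + j)) = j.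
Proof.
apply/eqP; rewrite eqn_leq; apply/andP; split.
  by apply/chain_dist; apply: chain_nat; exact: Hy_edge.
by case: Hg => _; apply; apply/chain_dist.
Qed.

Lemma sd_ray m k : sd (Hy g m) (g k) = (k <= m).
Proof.
rewrite /sd /=; case: (leqP k m) => le.
  rewrite -(subnKC le) -addnS !ray_dist; lia.
rewrite [dist (g k) _]dist_sym -(subnKC le) [dist _ (g m.+1)]dist_sym ray_dist.
by rewrite addSnnS ray_dist; lia.
Qed.

Lemma sep_ray m k l : sep (Hy g m) (g k) (g l) = ((k <= m) != (l <= m)).
Proof. by rewrite /sep !sd_ray. Qed.

Lemma theta_Hy i j : theta (Hy g i) (Hy g j) -> i = j.
Proof.
move=> T; have := theta_sep HX T (Hy_edge i) (g i) (g i.+1).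
by rewrite !sep_ray; lia.
Qed.

Lemma sep_ray_theta V k l : is_edge V -> sep V (g k) (g l) -> exists r, theta V (Hy g r).
Proof.
move=> E; wlog le : k l / k <= l.
  by move=> H; case/orP: (leq_total k l) => le S; [|rewrite sepC in S]; apply: H le S.
move=> S; have [|i _ Si] := @bool_switch (fun i => sd V (g (k + i))) (l - k).
  by rewrite addn0 subnKC.
exists (k + i); apply: (@sep_theta _ HX V (g (k + i)) (g (k + i).+1)) => //.
  exact: Hy_edge.
by rewrite -addnS.
Qed.

Lemma Kpp_of_seqs p (ss ts : seq nat) : p <= size ss -> p <= size ts ->
  uniq ss -> uniq ts -> (forall s t, s \in ss -> t \in ts -> s <> t /\ contact (Hy g s) (Hy g t)) ->
  Kpp_in_Lambda g p.
Proof.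
move=> ps pt us ut H.
exists (fun i => nth 0 ss i), (fun i => nth 0 ts i).
have S (i : 'I_p) : nth 0 ss i \in ss by apply: mem_nth; apply: leq_trans ps.
have T (i : 'I_p) : nth 0 ts i \in ts by apply: mem_nth; apply: leq_trans pt.
split=> x y.
- move=> N /theta_Hy/eqP; rewrite nth_uniq //; try exact: leq_trans (ltn_ord _) ps.
  by move/eqP/val_inj.
- move=> N /theta_Hy/eqP; rewrite nth_uniq //; try exact: leq_trans (ltn_ord _) pt.
  by move/eqP/val_inj.
- by move/theta_Hy; case: (H _ _ (S x) (T y)).
- by case: (H _ _ (S x) (T y)).
Qed.

(* A hyperplane separating the whole ray from [U] straddles the same [H_m] and is closer. *)
Lemma closest_straddling U (ms : seq nat) : is_edge U ->
  (forall m, m \in ms -> straddles U (Hy g m)) ->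
  exists U', [/\ is_edge U', (forall m, m \in ms -> straddles U' (Hy g m))
    & forall V, is_edge V -> ~ (forall k c, in_carrier U' c -> sep V (g k) c)].
Proof.
move=> EU SU.
pose P n := `[< exists U' c, [/\ is_edge U', (forall m, m \in ms -> straddles U' (Hy g m)),
  in_carrier U' c & dist (g 0) c = n] >].
have exP : exists n, P n.
  exists (dist (g 0) U.1); apply/asboolP; exists U, U.1; split=> //.
  by exists U; split; [exact: rst_refl|left].
case: (ex_minnP exP) => n /asboolP[U' [c [EU' SU' Nc Ec]]] min.
exists U'; split=> // V EV SV.
have [f [f0 fA fd]] := geo_fun HX (g 0) c.
have fdist := geo_fun_dist fA fd.
have fn : f (dist (g 0) c) = c by apply: (@dist0 _ HX); rewrite fd // subnn.
(* The geodesic from [g 0] to the nearest carrier vertex [c] crosses [V] before reaching [c], so [V]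
   has a strictly closer carrier vertex. *)
have [|i lt Si] := @bool_switch (sd V \o f) (dist (g 0) c).
  by rewrite /= f0 fn; exact: SV.
have Ni : in_carrier V (f i).
  by apply/(in_carrierP HX _ EV); exists (f i.+1) => //; exact: fA.
have : n <= i.
  apply: min; apply/asboolP; exists V, (f i); split=> //; last first.
    by rewrite -f0; have := fdist 0 i; rewrite add0n; apply; exact: ltnW.
  move=> m /SU'[c1 [c2 [N1 N2 S]]].
  apply: (@quadrants_straddle _ HX _ _ (g m) (g m.+1) c1 c2) => //;
    try exact: SV; first exact: Hy_edge.
  by rewrite sep_ray; lia.
by rewrite -Ec leqNgt lt.
Qed.

(** A geodesic from [g k] to its gate in the carrier has more than [R] edges. By the gate property,
    the hyperplane of each edge separates [g k] from the whole carrier. *)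
Lemma separating_indices U R k : is_edge U ->
  (forall V, is_edge V -> ~ (forall k c, in_carrier U c -> sep V (g k) c)) ->
  ~ in_NR R U (g k) ->
  exists rs : seq nat, [/\ uniq rs, size rs = R
    & forall r, r \in rs -> forall c, in_carrier U c -> sep (Hy g r) (g k) c].
Proof.
move=> EU noV far; set x := g k.
pose P n := `[< exists c, in_carrier U c /\ dist x c = n >].
have exP : exists n, P n.
  exists (dist x U.1); apply/asboolP; exists U.1; split=> //.
  by exists U; split; [exact: rst_refl|left].
case: (ex_minnP exP) => D /asboolP[u [Nu Eu]] min.
have gate := conv_gate (@carrier_conv _ HX _ EU) Nu.
have {}gate v : in_carrier U v -> dist x v = D + dist u v.
  rewrite -Eu; apply: gate => w Nw; rewrite Eu; apply: min.
  by apply/asboolP; exists w.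
have RD : R < D.
  rewrite ltnNge; apply/negP => le; apply: far; exists u; split=> //.
  by apply/(chain_dist HX); rewrite Eu.
have [f [f0 fA fd]] := geo_fun HX x u.
have fdist := geo_fun_dist fA fd; rewrite Eu in fA fd fdist.
have Vsep i : i < D -> forall c, in_carrier U c -> sep (f i, f i.+1) x c.
  move=> lt c Nc.
  have d1 : dist x (f i) = i by rewrite -f0 -{1}[i]add0n fdist //; lia.
  have d2 : dist x (f i.+1) = i.+1 by rewrite -f0 -{1}[i.+1]add0n fdist //; lia.
  have := gate c Nc; have := dist_tri HX (f i) x c; have := dist_tri HX (f i.+1) x c.
  have := dist_tri HX u (f i.+1) c; have := dist_tri HX u (f i) c.
  rewrite d1 d2 !fd ?(ltnW lt) // /sep /sd /= d1 d2 ltnSn ![dist c _]dist_sym => *.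
  by apply/eqP => /esym; apply/negP; lia.
have exr i : exists r, i < D -> theta (f i, f i.+1) (Hy g r).
  case: (ltnP i D) => [lt|_]; last by exists 0.
  have EV : is_edge (f i, f i.+1) by exact: fA.
  (* Some [g l] lies on the same side as a carrier vertex, so this hyperplane separates [g k] from
     [g l] and crosses the ray. *)
  have /existsNP[l /existsNP[c /not_implyP[Nc Nsep]]] := noV _ EV.
  have [|r T] := @sep_ray_theta _ k l EV; last by exists r.
  have := Vsep i lt c Nc; move/negP: Nsep; rewrite /sep /x; by do 3 case: sd.
have [r rT] := choice exr.
exists [seq r i | i <- iota 0 R]; split; [|by rewrite size_map size_iota|].
  rewrite map_inj_in_uniq ?iota_uniq // => i j; rewrite !mem_iota !add0n /=.
  wlog lt : i j / i < j.
    move=> H ltiR ltjR Er; case: (ltngtP i j) => // lt; first exact: H lt _ _ _.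
    by apply/esym; apply: H lt _ _ _.
  move=> iR jR Er.
  have iD : i < D by lia.
  have jD : j < D by lia.
  have Ti := rT i iD; have Tj := rT j jD; rewrite -Er in Tj.
  (* Equal indices would make two edges of one geodesic dual to the same hyperplane, which the later
     edge would then have to cross again. *)
  have Tij := rst_trans _ _ _ _ _ Ti (rst_sym _ _ _ _ Tj).
  have Sj : sep (f j, f j.+1) (f j) (f j.+1).
    have Ej : is_edge (f j, f j.+1) by exact: fA.
    by rewrite /sep (sd_fst HX Ej) (sd_snd HX Ej).
  have := theta_sep HX Tij (fA i iD) (f j) (f j.+1); rewrite Sj /sep /sd /=.
  rewrite ![dist (f j) _]dist_sym ![dist (f j.+1) _]dist_sym.
  have e a b : a <= b <= D -> dist (f a) (f b) = b - a.
    by move=> /andP[le leD]; rewrite -{1}(subnKC le) fdist // subnKC.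
  by rewrite !e; lia.
move=> r' /mapP[i]; rewrite mem_iota add0n /= => lt -> c Nc.
have iD : i < D by lia.
by rewrite -(theta_sep HX (rT i iD) (fA i iD)); exact: Vsep.
Qed.

(** * Bounds when the last two alternatives fail *)

Section Bounded.
Variables p t : nat.
Hypothesis noKpp : ~ Kpp_in_Lambda g p.
Hypothesis nofellow : forall h a, is_edge h ->
  exists2 k, a <= k <= a + t & ~ in_NR (2 * p) h (g k).

Lemma straddle_bound U0 ms : is_edge U0 -> uniq ms ->
  (forall m, m \in ms -> straddles U0 (Hy g m)) -> size ms <= 2 * p + t.
Proof.
move=> EU0 um SU0; rewrite leqNgt; apply/negP => big; apply: noKpp.
have [U [EU SU noV]] := closest_straddling EU0 SU0.
pose s := sort leq ms.
have szs : size s = size ms by rewrite size_sort.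
have Ss : sorted ltn s by rewrite ltn_sorted_uniq_leq sort_uniq um sort_sorted //; exact: leq_total.
have us : uniq s by rewrite sort_uniq.
have {}SU m : m \in s -> straddles U (Hy g m) by rewrite mem_sort; exact: SU.
clearbody s => {SU0 um}.
have [p0|pgt] := posnP p; first by apply: (@Kpp_of_seqs p [::] [::]); rewrite ?p0.
(* This window places the first [p] elements of [s] before [k] and the last [p] at or after [k]. *)
have [k /andP[lek gek] far] := nofellow (nth 0 s p.-1).+1 EU.
have [rs [urs szrs Srs]] := separating_indices EU noV far.
have cross m r : m \in s -> r \in rs -> (r < k <= m) || (m < k <= r) ->
    r <> m /\ contact (Hy g r) (Hy g m).
  move=> ms' rrs lt; split; first by lia.
  have [c1 [c2 [N1 N2 S]]] := SU m ms'.
  apply: (@straddles_contact _ HX); try exact: Hy_edge.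
  have S1 := Srs r rrs c1 N1; have S2 := Srs r rrs c2 N2.
  (* Since [k] separates [r] from [m], both ends of the edge dual to [Hy g m] lie on the side of
     [g k], whereas [c1] and [c2] lie beyond [Hy g r]. *)
  have E1 : sd (Hy g r) (g m) = sd (Hy g r) (g k) by rewrite !sd_ray; move: lt; clear; lia.
  have E2 : sd (Hy g r) (g m.+1) = sd (Hy g r) (g k) by rewrite !sd_ray; move: lt; clear; lia.
  apply: (@quadrants_straddle _ HX _ _ (g m) (g m.+1) c1 c2); rewrite ?/sep ?E1 ?E2 //;
    try exact: Hy_edge.
  by rewrite !sd_ray leqnn ltnn.
(* Of the [2 * p] indices in [rs], at least [p] are below [k] or at least [p] are not; they are
   paired with the last or the first [p] elements of [s]. *)
have := count_predC (fun r => r < k) rs; rewrite szrs -!size_filter => szf.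
have [le|gt] := leqP p (size [seq r <- rs | r < k]).
  apply: (@Kpp_of_seqs p [seq r <- rs | r < k] (drop (size s - p) s)) => //.
  - by rewrite size_drop szs; lia.
  - exact: filter_uniq.
  - exact: drop_uniq.
  move=> r m; rewrite mem_filter => /andP[lt rrs] ms'; apply: cross => //.
    exact: mem_drop ms'.
  rewrite lt /=; apply/orP; left; apply: leq_trans gek _.
  by apply: ltn_sorted_drop ms'; rewrite ?szs.
apply: (@Kpp_of_seqs p (filter (predC (fun r => r < k)) rs) (take p s)).
- lia.
- by rewrite size_take szs; case: ifP; lia.
- exact: filter_uniq.
- exact: take_uniq.
move=> r m; rewrite mem_filter => /andP[/= ge rrs] ms'; apply: cross => //.
  exact: mem_take ms'.
apply/orP; right; rewrite -leqNgt in ge; rewrite ge andbT; apply: leq_trans lek.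
by apply: ltn_sorted_take ms'; rewrite // szs; lia.
Qed.

(** For a vertex [v] common to the first two carriers, each [Hy g m] is straddled by [e] or
    separates [v] from [c']. The endpoints [c], [c'] may depend on [m], which lets the induction
    pass to the rest of the chain. *)
Lemma contact_chain_bound n e f : chain (@contact X) n e f -> is_edge e -> forall ms, uniq ms ->
  (forall m, m \in ms -> exists c c', [/\ in_carrier e c, in_carrier f c' & sep (Hy g m) c c']) ->
  size ms <= n.+1 * (2 * p + t).
Proof.
elim=> {n e f} [n e|n e y f [_ [Ey [e' [y' [Te [Ty Ev]]]]]] _ IH] Ee ms um H.
  apply: leq_trans (straddle_bound Ee um _) _; last by rewrite mulSn leq_addr.
  by move=> m /H[c [c' [? ? ?]]]; exists c, c'.
have [v Ne Ny] : exists2 v, in_carrier e v & in_carrier y v.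
  case: Ev => [E|[E|[E|E]]]; [exists e'.1|exists e'.1|exists e'.2|exists e'.2];
    by [exists e'; split=> //; auto|exists y'; split=> //; rewrite E; auto].
pose st m := `[< straddles e (Hy g m) >].
rewrite -(count_predC st) -!size_filter mulSn leq_add //.
  apply: (straddle_bound Ee); first exact: filter_uniq.
  by move=> m; rewrite mem_filter => /andP[/asboolP].
apply: IH => //; first exact: filter_uniq.
move=> m; rewrite mem_filter => /andP[/= /asboolP nst /H[c [c' [Nc Nc' S]]]].
exists v, c'; split=> //; apply: contra_notT nst => nS; exists c, v; split=> //.
by move: S nS; rewrite /sep; do 3 case: sd.
Qed.

Lemma contact_sym e f : contact e f -> @contact X f e.
Proof.
move=> [Ee [Ef [e' [f' [Te [Tf E]]]]]]; split=> //; split=> //; exists f', e'; split=> //.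
by split=> //; case: E => [|[|[|]]] ->; auto.
Qed.

Lemma contact_Hy i : contact (Hy g i) (Hy g i.+1).
Proof.
split; [exact: Hy_edge|split; first exact: Hy_edge].
exists (Hy g i), (Hy g i.+1); split; first exact: rst_refl.
by split; [exact: rst_refl|auto].
Qed.

(** The [j] hyperplanes crossed between [g i] and [g (i + j)] separate these two vertices, which lie
    in the carriers at the ends of the chain. *)
Lemma qi_of_bounds : qi_alternative g.
Proof.
set B := 2 * p + t.
have main i j n : chain (@contact X) n (Hy g i) (Hy g (i + j)) -> j <= n.+1 * B.
  move=> C; rewrite -(size_iota i j).
  apply: (contact_chain_bound C (Hy_edge i)); first exact: iota_uniq.
  move=> m; rewrite mem_iota => lt; exists (g i), (g (i + j)); split.
  - by exists (Hy g i); split; [exact: rst_refl|left].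
  - by exists (Hy g (i + j)); split; [exact: rst_refl|left].
  - by rewrite sep_ray; lia.
(* The factor [B.+1] instead of [B] also makes the bound at least [j] in the upper estimate when
   [B = 0]. *)
split; exists B.+1, B; split.
- by move=> i j n /main; nia.
- move=> i j; apply: (@chain_leq _ _ j); first by nia.
  by apply: (chain_nat (s := Hy g)); exact: contact_Hy.
- move=> i j n C.
  (* The path in [Lambda] is the stretch of the ray's own hyperplanes from [k] to [l]. *)
  have up k l : k <= l -> chain (@contact X) n (Hy g k) (Hy g l) ->
      chain (lam_rel g) (B.+1 * n + B) k l.
    move=> le; rewrite -(subnKC le) => /main; set d := l - k => led.
    apply: (@chain_leq _ _ d); first by nia.
    by apply: (chain_nat (s := id)); exact: contact_Hy.
  case/orP: (leq_total i j) => le; first exact: up.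
  apply: chain_sym; first by move=> x y; exact: contact_sym.
  by apply: up => //; apply: chain_sym C; exact: contact_sym.
- move=> i j n C; apply: (@chain_leq _ _ n); first by nia.
  elim: C => {i j n} [n i|n i k j A _ IH]; first exact: chain0.
  exact: (@chainS _ _ n (Hy g i) (Hy g k)).
Qed.

End Bounded.
End Ray.

Theorem theorem2p2 (X : CubeData) (HX : CAT0 X) (g : nat -> X)
  (Hg : geodesic_ray g) :
  qi_alternative g \/ (forall p : nat, Kpp_in_Lambda g p) \/ fellow_alternative g.
Proof.
case: (pselect (forall p : nat, Kpp_in_Lambda g p)) => [H|/existsNP[p noK]]; first by right; left.
case: (pselect (fellow_alternative g)) => [H|noF]; first by right; right.
(* Failure of the third alternative at radius [2 * p] supplies the length [t]. *)
left; have [t noF'] : exists t, forall h a, is_edge h ->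
    exists2 k, a <= k <= a + t & ~ in_NR (2 * p) h (g k).
  apply: contrapT => H; apply: noF; exists (2 * p) => t.
  apply: contrapT => H1; apply: H; exists t => h a Eh.
  apply: contrapT => H2; apply: H1; exists h; split=> //; exists a => k lek.
  by apply: contrapT => H3; apply: H2; exists k.
exact: (qi_of_bounds HX Hg noK noF').
Qed.
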